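(* There exist separable metric spaces with arbitrarily large packing dimension that cannot be mapped onto an interval by a continuous function. That is, for every real number $t$ there is a separable metric space $X$ with $\dim_{\mathsf P}X\geq t$ such that no continuous function $f:X\to\mathbb R$ has as its image a nondegenerate interval.
   Context: The statement is a theorem of ZFC (no additional set-theoretic hypothesis). $B(x,r)$ denotes the closed ball with center $x$ and radius $r>0$. Packing measure. Let $E$ be a subset of a metric space $X$. A family of balls $\{B(x_i,r_i):i\in I\}$ is a packing of $E$ if $x_i\in E$ for all $i$ and $x_j\notin B(x_i,r_i)$ whenever $i\neq j$. It is $\delta$-fine if $r_i\le\delta$ for all $i$. For $s>0$ let $\mathcal P^s_\delta(E)=\sup\{\sum_{i\in I}r_i^s:\{B(x_i,r_i):i\in I\}\text{ is a }\delta\text{-fine packing of }E\}$, $\mathcal P^s_0(E)=\inf_{\delta>0}\mathcal P^s_\delta(E)$, and $\mathcal P^s(E)=\inf\sum_n\mathcal P^s_0(E_n)$, the infimum being over all countable covers $\{E_n\}$ of $E$. Packing dimension: $\dim_{\mathsf P}E=\inf\{s>0:\mathcal P^s(E)=0\}\in[0,\infty]$. *)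

(* Defs.v *)
From HB Require Import structures.
From mathcomp Require Import all_boot all_order all_algebra.
From mathcomp Require Import all_classical all_reals all_analysis.

Set Implicit Arguments.
Unset Strict Implicit.
Unset Printing Implicit Defensive.

Import Order.TTheory GRing.Theory Num.Theory.
Import numFieldNormedType.Exports.

Local Open Scope classical_set_scope.
Local Open Scope ring_scope.

Definition separable (T : topologicalType) : Prop :=
  exists2 D : set T, countable D & dense D.

(* [closed_ball] of the library is the closure of the open ball, which in a
   general metric space may be smaller than this set. *)
Definition metric_closed_ball (R : realType) (X : metricType R)
  (x : X) (r : R) : set X := [set y | mdist x y <= r].

(* A ball of a packing is recorded by its center and radius. *)
Definition is_packing (R : realType) (X : metricType R) (E : set X)
  (I : Type) (x : I -> X) (r : I -> R) : Prop :=
  [/\ forall i, 0 < r i,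
      forall i, E (x i)
    & forall i j, i <> j -> ~ metric_closed_ball (x i) (r i) (x j)].

Definition packing_fine (R : realType) (I : Type) (r : I -> R) (delta : R) :
  Prop := forall i, r i <= delta.

Definition packing_delta (R : realType) (X : metricType R) (s delta : R)
  (E : set X) : \bar R :=
  ereal_sup [set v | exists (I : choiceType) (x : I -> X) (r : I -> R),
    [/\ is_packing E x r, packing_fine r delta
      & v = \esum_(i in [set: I]) (r i `^ s)%:E]].

Definition packing_premeasure (R : realType) (X : metricType R) (s : R)
  (E : set X) : \bar R :=
  ereal_inf [set packing_delta s delta E | delta in [set d : R | 0 < d]].

(* Finite covers are included, padded with empty sets of premeasure 0. *)
Definition packing_measure (R : realType) (X : metricType R) (s : R)
  (E : set X) : \bar R :=
  ereal_inf [set v | exists F : nat -> set X,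
    E `<=` \bigcup_n F n /\
    v = (\sum_(0 <= n <oo) packing_premeasure s (F n))%E].

Definition packing_dim (R : realType) (X : metricType R) (E : set X) :
  \bar R :=
  ereal_inf [set s%:E | s in [set s : R | 0 < s /\ packing_measure s E = 0%E]].

Definition nondegenerate_interval (R : realType) (A : set R) : Prop :=
  is_interval A /\ exists a b : R, [/\ A a, A b & a < b].

(* Main.v *)
From HB Require Import structures.
Require Import Defs.
From mathcomp Require Import all_boot all_order all_algebra.
From mathcomp Require Import all_classical all_reals all_analysis.
From mathcomp Require Import wochoice lra.
Set Implicit Arguments.
Unset Strict Implicit.
Unset Printing Implicit Defensive.

Import Order.TTheory GRing.Theory Num.Theory.
Import numFieldNormedType.Exports.
Local Open Scope classical_set_scope.
Local Open Scope ring_scope.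

(** The packing dimension can even be made infinite. Work in Baire space
[nat -> nat] with the ultrametric that puts [x] and [y] at distance [1 / (m + 1)]
when [m] is the first place where they differ.

Large dimension. A set whose packing premeasure is finite is totally bounded,
because infinitely many points at mutual distance at least some [e > 0] give
packings by equal balls, arbitrarily small, whose sums diverge. In Baire space
a totally bounded set lies below a single function. So if the packing measure
of [A] vanishes for some exponent, then [A] is covered by countably many sets
each lying below one function, and a diagonal maximum bounds all of [A] for
eventual domination. An unbounded family thus has infinite packing dimension
([packing_dim_unbounded]).

No map onto an interval. Let [Q] be the countable dense set of eventually zero
sequences. The space is [Q] together with an unbounded family [F] that is
concentrated on [Q], in the sense that outside every open neighborhood of [Q]
there is no copy of the set [nat -> bool] inside [F]. Suppose [f] is continuous
and its range contains [[a, c]] with [a < c]. Some Cantor set in [[a, c]] stays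
at a distance at least [eps n] from the image of the [n]-th point of [Q]
([cantor_avoiding]); choosing a preimage of each of its points gives a copy of
[nat -> bool] in [F] outside a neighborhood of [Q], which is absurd
([concentrated_no_interval]).

Such an [F] exists without any extra axiom ([exists_concentrated]), by a
dichotomy on the cardinal usually called b, the least size of an unbounded
family. If b is less than the continuum, any unbounded family of size b will do.
Otherwise every family of size less than the continuum is bounded. Enumerate
all functions along a well-order whose initial segments are smaller than the
continuum; a neighborhood of [Q] is coded by a function, so the neighborhoods
coded before stage [b] are controlled by a single function [h b]. By a Baire
category argument ([exists_generic]) there is a point [x b] lying in all of
them and not dominated by the [b]-th function. These points form [F]: it is
unbounded, and outside the neighborhood coded at stage [a] only points with
index before [a] remain. *)

(** * Baire space and its subspaces *)

Definition agree (n : nat) (x y : nat -> nat) : Prop :=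
  forall i, (i < n)%N -> x i = y i.

Definition prefix_dist (R : realType) (x y : nat -> nat) : R :=
  if pselect (exists n, x n != y n) is left d then (ex_minn d).+1%:R^-1 else 0.

Lemma prefix_dist_lt (R : realType) (x y : nat -> nat) (n : nat) :
  (prefix_dist R x y < n.+1%:R^-1) <-> agree n.+1 x y.
Proof.
rewrite /prefix_dist; case: pselect => [d|nd].
  case: ex_minnP => m xym minm.
  rewrite ltf_pV2 ?posrE ?ltr0n// ltr_nat ltnS; split=> [nm i|xy].
    rewrite ltnS => ilen; apply/eqP; apply: contraTT nm => /minm mi.
    by rewrite -leqNgt (leq_trans mi).
  by rewrite ltnNge; apply/negP => mn; move: xym; rewrite (xy m) ?eqxx.
split=> [_ i _|_]; last by rewrite invr_gt0 ltr0n.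
by apply: contrapT => /eqP xy; apply: nd; exists i.
Qed.

(** Case analysis on the first place of disagreement; nonnegativity, symmetry
and the triangle inequality all reduce to it and to [prefix_dist_ge]. *)
Lemma prefix_distP (R : realType) (x y : nat -> nat) :
  (prefix_dist R x y = 0 /\ x = y) \/
  exists2 m, x m <> y m & prefix_dist R x y = m.+1%:R^-1.
Proof.
rewrite /prefix_dist; case: pselect => [d|nd]; [right|left].
  by case: ex_minnP => m /eqP xym _; exists m.
split=> //; apply/funext => i; apply: contrapT => /eqP xy.
by apply: nd; exists i.
Qed.

Lemma prefix_dist_ge (R : realType) (x y : nat -> nat) (m : nat) :
  x m <> y m -> m.+1%:R^-1 <= prefix_dist R x y.
Proof.
by move=> xy; rewrite leNgt; apply/negP => /prefix_dist_lt/(_ m (ltnSn m)).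
Qed.

Lemma prefix_dist_ge0 (R : realType) (x y : nat -> nat) : 0 <= prefix_dist R x y.
Proof. by case: (prefix_distP R x y) => [[->]|[m _ ->]]//; rewrite invr_ge0. Qed.

Lemma prefix_distxx (R : realType) (x : nat -> nat) : prefix_dist R x x = 0.
Proof. by case: (prefix_distP R x x) => [[]|[m]]. Qed.

Lemma prefix_dist_le_sym (R : realType) (x y : nat -> nat) :
  prefix_dist R x y <= prefix_dist R y x.
Proof.
case: (prefix_distP R x y) => [[-> _]|[m xy ->]]; first exact: prefix_dist_ge0.
by apply: prefix_dist_ge => /esym.
Qed.

Lemma prefix_dist_triangle (R : realType) (y x z : nat -> nat) :
  prefix_dist R x z <= prefix_dist R x y + prefix_dist R y z.
Proof.
case: (prefix_distP R x z) => [[-> _]|[m xz ->]].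
  by rewrite addr_ge0 ?prefix_dist_ge0.
have [xy|/eqP xy] := eqVneq (x m) (y m).
  rewrite -[leLHS]add0r lerD ?prefix_dist_ge0//.
  by apply: prefix_dist_ge; rewrite -xy.
by rewrite -[leLHS]addr0 lerD ?prefix_dist_ge0// prefix_dist_ge.
Qed.

(** The field is a phantom parameter: distances take their values in it, so it
has to be recoverable from the type for the metric structure to be inferred. *)
Definition baire_subspace (R : realType) (A : set (nat -> nat)) : Type :=
  {x : nat -> nat | A x}.

Section BaireSubspaceMetric.
Context {R : realType} {A : set (nat -> nat)}.
Local Notation X := (baire_subspace R A).

HB.instance Definition _ := gen_eqMixin X.
HB.instance Definition _ := gen_choiceMixin X.

Let dist (x y : X) : R := prefix_dist R (sval x) (sval y).

Let distxx (x : X) : dist x x = 0. Proof. exact: prefix_distxx. Qed.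

Let dist_positivity (x y : X) : dist x y = 0 -> x = y.
Proof.
rewrite /dist; case: (prefix_distP R (sval x) (sval y)) => [[_]|[m _ ->]].
  by move=> xy _; exact: eq_sig_hprop xy.
by move/eqP; rewrite invr_eq0 pnatr_eq0.
Qed.

Let dist_sym (x y : X) : dist x y = dist y x.
Proof. by apply/eqP; rewrite eq_le !prefix_dist_le_sym. Qed.

Let dist_triangle (y x z : X) : dist x z <= dist x y + dist y z.
Proof. exact: prefix_dist_triangle. Qed.

HB.instance Definition _ :=
  isMetric.Build R X distxx dist_positivity dist_sym dist_triangle.

Lemma mdistE (x y : X) : mdist x y = prefix_dist R (sval x) (sval y).
Proof. by []. Qed.

End BaireSubspaceMetric.

Lemma nbhs_agree (R : realType) (A : set (nat -> nat))
    (x : baire_subspace R A) (U : set (baire_subspace R A)) :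
  nbhs x U -> exists n, forall y, agree n (sval y) (sval x) -> U y.
Proof.
rewrite -metricType_numDomainType.nbhs_nbhs_mdist => -[e /= e0 eU].
exists (Num.truncn e^-1).+1 => y yx; apply: eU => /=.
rewrite mdistE (@lt_trans _ _ (Num.truncn e^-1).+1%:R^-1)//.
  by apply/prefix_dist_lt => i /yx.
by rewrite -[ltRHS]invrK ltf_pV2 ?posrE ?invr_gt0// truncnS_gt.
Qed.

(** * Unbounded families have infinite packing dimension *)

Definition dominated (x h : nat -> nat) : Prop :=
  exists m, forall n, (m <= n)%N -> (x n <= h n)%N.

Definition bounded_family (F : set (nat -> nat)) : Prop :=
  exists h, forall x, F x -> dominated x h.

Section PackingMeasure.
Context {R : realType} {A : set (nat -> nat)}.
Local Notation X := (baire_subspace R A).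

(** Points with pairwise distinct values at [k] are at mutual distance at least
[1 / (k + 1)], so infinitely many of them are the centers of a packing by balls
of one fixed radius, which can be taken below any [delta]. *)
Lemma packing_delta_pinfty (s delta : R) (E : set X) (k : nat) :
  0 < delta -> (forall h, exists2 x, E x & (h < sval x k)%N) ->
  packing_delta s delta E = +oo%E.
Proof.
move=> d0 unbdd.
have [x xP] : exists x : nat -> X,
    forall n, E (x n) /\ (sval (x n) k < sval (x n.+1) k)%N.
  have next (p : X) : exists q : X, E q /\ (sval p k < sval q k)%N.
    by have [q Eq pq] := unbdd (sval p k); exists q.
  have [nx nxP] := choice next.
  have [x0 Ex0 _] := unbdd 0%N.
  exists (fun n => iter n.+1 nx x0) => n; split.
    by rewrite iterS; exact: (nxP _).1.
  by rewrite [iter n.+2 _ _]iterS; exact: (nxP _).2.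
have xinj : injective (fun n => sval (x n) k).
  have /leq_mono/= mono : {homo (fun n => sval (x n) k) : m n / (m < n)%N}.
    by apply: homo_ltn => [? ? ?|n]; [exact: ltn_trans|exact: (xP n).2].
  by move=> m n /eqP; rewrite eqn_leq !mono -eqn_leq => /eqP.
(* Closed balls are used, so the radius stays strictly below [1 / (k + 1)]. *)
pose r := Num.min delta k.+2%:R^-1.
have r0 : 0 < r by rewrite lt_min d0 invr_gt0 ltr0n.
have infsum : \esum_(i in [set: nat]) (r `^ s)%:E = +oo%E.
  apply/eqyP => c c0; apply: esum_ge; set v := r `^ s.
  have v0 : 0 < v by rewrite powR_gt0.
  exists `I_(Num.truncn (c / v)).+1; first by split; first exact: finite_II.
  rewrite -fsbig_ord/= sumEFin lee_fin sumr_const card_ord -[leRHS]mulr_natl.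
  by rewrite -ler_pdivrMr// ltW// truncnS_gt.
apply/eqP; rewrite -leye_eq -infsum; apply: ereal_sup_ubound => /=.
exists nat, x, (fun=> r); split=> //; last first.
  by move=> _; rewrite ge_min lexx.
split=> // [i|i j ij]; first exact: (xP i).1.
rewrite /metric_closed_ball/= mdistE; apply/negP; rewrite -ltNge.
have/(prefix_dist_ge R) : sval (x i) k <> sval (x j) k by move/xinj.
apply: lt_le_trans; rewrite gt_min ltf_pV2 ?posrE ?ltr0n// ltr_nat.
by rewrite ltnSn orbT.
Qed.

Lemma packing_delta_ge0 (s delta : R) (E : set X) :
  (0 <= packing_delta s delta E)%E.
Proof.
apply: ereal_sup_ubound => /=; exists void, (of_void X), (of_void R).
by split=> //; rewrite esum1// => -[].
Qed.

Lemma packing_premeasure_ge0 (s : R) (E : set X) :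
  (0 <= packing_premeasure s E)%E.
Proof. by apply: le_ereal_inf_tmp => _ [d _ <-]; exact: packing_delta_ge0. Qed.

Lemma packing_premeasure_bounded (s : R) (E : set X) :
  packing_premeasure s E != +oo%E ->
  exists h : nat -> nat, forall x, E x -> forall k, (sval x k <= h k)%N.
Proof.
move=> fin; apply: contrapT => unbdd; move: fin; apply/negP; rewrite negbK.
have [k kP] : exists k, forall h, exists2 x, E x & (h < sval x k)%N.
  apply: contrapT => /forallNP nk; apply: unbdd.
  have /choice[h hP] k : exists h, forall x, E x -> (sval x k <= h)%N.
    have /existsNP[h nh] := nk k; exists h => x Ex.
    by rewrite leqNgt; apply/negP => hx; apply: nh; exists x.
  by exists h => x Ex k; exact: hP.
apply/eqP/ereal_inf_pinfty => _ [d /= d0 <-].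
exact: (packing_delta_pinfty _ d0 kP).
Qed.

(** Were the measure zero, the space would be a countable union of sets [F n]
lying pointwise below some [h n], and the maximum of [h 0 k], ..., [h k k] as a
function of [k] would eventually dominate every point. *)
Lemma packing_measure_unbounded (s : R) :
  ~ bounded_family A -> packing_measure s [set: X] <> 0%E.
Proof.
move=> unbdd pm0; apply: unbdd.
have : (packing_measure s [set: X] < 1)%E by rewrite pm0 lte01.
move=> /ereal_inf_lt[_ [F [cover ->]] sum1].
have pos n : (0 <= packing_premeasure s (F n))%E.
  exact: packing_premeasure_ge0.
have /choice[h hP] n : exists h : nat -> nat,
    forall x, F n x -> forall k, (sval x k <= h k)%N.
  apply: (@packing_premeasure_bounded s); apply/eqP => Fn.
  by move: sum1; rewrite (@nneseries_pinfty _ _ _ n).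
exists (fun k => \max_(n < k.+1) h n k)%N => x Ax.
have [n _ Fnx] := cover (exist _ x Ax) I.
exists n => k nk; apply: leq_trans (hP n _ Fnx k) _.
by rewrite (leq_bigmax (Ordinal (nk : (n < k.+1)%N))).
Qed.

Lemma packing_dim_unbounded :
  ~ bounded_family A -> packing_dim [set: X] = +oo%E.
Proof.
move=> unbdd; apply/ereal_inf_pinfty => _ [s [_ pm0] <-].
by case: (packing_measure_unbounded unbdd pm0).
Qed.

End PackingMeasure.

(** * Sets without a copy of the continuum *)

(** Classically the negation says that [A] has cardinality less than the
continuum; this form needs no cardinal arithmetic. *)
Definition has_continuum (T : Type) (A : set T) : Prop :=
  exists2 xi : (nat -> bool) -> T, injective xi & forall b, A (xi b).

Lemma has_continuum_image (T U : Type) (f : T -> U) (A : set T) :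
  has_continuum (f @` A) -> has_continuum A.
Proof.
move=> [xi xi_inj xiA].
have /choice[g gP] b : exists a, A a /\ f a = xi b.
  by have [a Aa <-] := xiA b; exists a.
exists g => [b c gbc|b]; last exact: (gP b).1.
by apply: xi_inj; rewrite -(gP b).2 -(gP c).2 gbc.
Qed.

Lemma has_continuum_subset (T : Type) (A B : set T) :
  A `<=` B -> has_continuum A -> has_continuum B.
Proof. by move=> AB [xi ? xiA]; exists xi => // b; exact/AB/xiA. Qed.

(** A subset of [nat * nat] codes the function sending [n] to the least [k] with
[(n, k)] in the subset, and every function is coded by its graph. *)
Lemma bool_seq_onto_nat_seq :
  exists e : (nat -> bool) -> (nat -> nat), forall z, exists b, e b = z.
Proof.
pose e (b : nat -> bool) (n : nat) : nat :=
  if pselect (exists k, b (pickle (n, k))) is left d then ex_minn d else 0%N.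
exists e => z.
exists (fun m => if unpickle m is Some (n, k) then k == z n else false).
apply/funext => n; rewrite /e; case: pselect => [d|[]].
  by case: ex_minnP => k; rewrite pickleK => /eqP.
by exists (z n); rewrite pickleK.
Qed.

(** This replaces indexing by the ordinal of the continuum. Well-order
[nat -> bool]; if some initial segment already contains a copy of the continuum,
keep only the least such segment, which still enumerates all functions by
inverting the embedding. *)
Lemma exists_thin_wellorder : exists (W : set (nat -> bool))
    (lt : rel (nat -> bool)) (e : (nat -> bool) -> (nat -> nat)),
  [/\ forall z, exists2 a, W a & e a = z,
      forall a b, lt a b \/ a = b \/ lt b a
    & forall b, W b -> ~ has_continuum [set a | W a /\ lt a b]].
Proof.
have [le wo] := well_ordering_principle (nat -> bool : eqType).
have least (P : set (nat -> bool)) : P !=set0 ->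
    exists2 z, P z /\ (forall x, P x -> le z x) &
      forall y, P y -> (forall x, P x -> le y x) -> z = y.
  move=> [p Pp]; pose Pb : {pred nat -> bool} := fun x => `[< P x >].
  have [|z [[/asboolP Pz minz] uz]] := wo Pb; first by exists p; apply/asboolP.
  exists z; first by split=> // x Px; apply: minz; apply/asboolP.
  move=> y Py miny; apply: uz.
  by split; [apply/asboolP|move=> x /asboolP; exact: miny].
pose lt a b := ~~ le b a.
have tri a b : lt a b \/ a = b \/ lt b a.
  rewrite /lt; case ba: (le b a); last by left.
  case ab: (le a b); last by right; right.
  right; left.
  have lexx x : le x x 
    by have [|z [-> minx] _] := least [set x]; [exists x|exact: minx].
  have [|z _ uz] := least [set a; b]; first by exists a; left.
  by rewrite -(uz a) ?(uz b)//; [right|move=> x [->|->]|left|move=> x [->|->]].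
have [e eP] := bool_seq_onto_nat_seq.
have [thin|/existsNP[b0 /contrapT big0]] :=
    pselect (forall b, ~ has_continuum [set a | lt a b]).
  exists setT, lt, e; split=> // [z|b _].
    by have [b <-] := eP z; exists b.
  by move=> /(has_continuum_subset (fun x (h : _ /\ _) => h.2)); exact: thin.
have [|b [bigb minb] _] := least (fun b => has_continuum [set a | lt a b]).
  by exists b0.
(* [g] inverts [xi] on its range, so the segment still reaches every code. *)
have [xi xi_inj xib] := bigb.
have /choice[g gP] a : exists c, forall d, a = xi d -> c = d.
  have [[d ->]|nd] := pselect (exists d, a = xi d).
    by exists d => c /xi_inj.
  by exists xpredT => d ad; case: nd; exists d.
exists [set a | lt a b], lt, (e \o g); split=> // [z|a /= ab].
  have [d <-] := eP z; exists (xi d); first exact: xib.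
  by rewrite /= (gP _ d erefl).
move=> /(has_continuum_subset (fun x (h : _ /\ _) => h.2)) => biga.
by move: ab; rewrite /lt minb.
Qed.

(** * Points near every earlier neighborhood of the dense set *)

(** The eventually zero sequences, enumerated through codes of finite lists. *)
Definition stem (n : nat) : nat -> nat :=
  nth 0%N (odflt [::] (unpickle n : option (seq nat))).

(** Appending zeros to [s] changes its code but not the sequence it denotes, so
every eventually zero sequence is listed infinitely often. *)
Lemma stem_cofinal (s : seq nat) (m : nat) :
  exists2 n, (m <= n)%N & stem n = nth 0%N s.
Proof.
pose code i := pickle (s ++ nseq i 0%N).
have stem_code i : stem (code i) = nth 0%N s.
  apply/funext => k; rewrite /stem /code pickleK/= nth_cat nth_nseq if_same.
  by case: ltnP => // ?; rewrite nth_default.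
apply: contrapT => small.
have: (size (map code (iota 0 m.+1)) <= size (iota 0 m))%N.
  apply: uniq_leq_size.
    rewrite map_inj_uniq ?iota_uniq// => i j /(pcan_inj pickleK)/(congr1 size).
    by rewrite !size_cat !size_nseq => /addnI.
  move=> _ /mapP[i _ ->]; rewrite mem_iota/= add0n ltnNge; apply/negP => mi.
  by apply: small; exists (code i).
by rewrite size_map !size_iota ltnn.
Qed.

(** The first condition defines the dense G_delta set of points that are within
the radius coded by [h n] of the [n]-th stem for infinitely many [n]; the points
not dominated by [g] also contain a dense G_delta set. A common point is built
as the union of finite lists, each step serving one instance of both conditions.

Asking for infinitely many [n], and not just one, lets [h] be replaced by any
function that it eventually dominates. *)
Lemma exists_generic (h g : nat -> nat) : exists x,
  (forall m, exists2 n, (m <= n)%N & agree (h n) x (stem n)) /\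
  ~ dominated x g.
Proof.
pose extends (j : nat) (s t : seq nat) :=
  [/\ forall i, (i < size s)%N -> nth 0%N t i = nth 0%N s i,
     exists2 i, (size s <= i < size t)%N & (g i < nth 0%N t i)%N
   & exists2 n, (j <= n)%N &
       forall i, (i < h n)%N -> (i < size t)%N /\ nth 0%N t i = stem n i].
have /choice[next nextP] (js : nat * seq nat) : exists t, extends js.1 js.2 t.
  (* Exceed [g] at the next place, then follow the stem so obtained long enough
     to agree with it up to [h n]. *)
  case: js => j s /=; pose s' := rcons s (g (size s)).+1.
  have [n jn stn] := stem_cofinal s' j.
  pose l := maxn (h n) (size s').
  exists (mkseq (stem n) l); split=> /= [i ilt||].
  - rewrite nth_mkseq ?stn ?nth_rcons ?ilt// leq_max size_rcons.
    by rewrite ltnS (ltnW ilt) orbT.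
  - exists (size s); first by rewrite leqnn size_mkseq leq_max size_rcons ltnSn orbT.
    rewrite nth_mkseq; last by rewrite leq_max size_rcons ltnSn orbT.
    by rewrite stn nth_rcons ltnn eqxx.
  - exists n => // i ih.
    by rewrite size_mkseq nth_mkseq; rewrite leq_max ih.
pose S := fix S j := if j is k.+1 then next (k, S k) else [::].
have SP j : extends j (S j) (S j.+1) by exact: (nextP (j, S j)).
have sizeS j : (j <= size (S j))%N.
  elim: j => // j IH; have [_ [i /andP[si it] _] _] := SP j.
  by rewrite (leq_ltn_trans IH)// (leq_ltn_trans si).
have S_mono j d : (size (S j) <= size (S (d + j)))%N /\
    forall i, (i < size (S j))%N -> nth 0%N (S (d + j)%N) i = nth 0%N (S j) i.
  elim: d => [|d [IHs IHn]]; first by [].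
  have [coh [i /andP[si it] _] _] := SP (d + j)%N; split.
    by rewrite (leq_trans IHs)// addSn ltnW// (leq_ltn_trans si).
  move=> k kj; rewrite addSn coh ?IHn//.
  exact: leq_trans kj IHs.
pose x i := nth 0%N (S i.+1) i.
have xE j i : (i < size (S j))%N -> x i = nth 0%N (S j) i.
  move=> ij; rewrite /x -(S_mono j i.+1).2// [(i.+1 + j)%N]addnC.
  by rewrite (S_mono i.+1 j).2 ?sizeS.
exists x; split=> [m|[m mP]].
  have [_ _ [n mn nP]] := SP m; exists n => // i /nP[it <-].
  exact: xE.
have [_ [i /andP[si it] gi] _] := SP m.
have := mP i (leq_trans (sizeS m) si).
by rewrite (xE m.+1)// leqNgt gi.
Qed.

(** * A concentrated unbounded family *)

(** As [g] varies these sets form a base of neighborhoods of the set of all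
stems, which is why functions can code open sets here. *)
Definition stem_nbhd (g : nat -> nat) : set (nat -> nat) :=
  [set x | exists n, agree (g n) x (stem n)].

(** Both cases of the dichotomy described above. In the second one no
transfinite recursion is needed: [x b] depends on the functions enumerated up to
[b], but not on the points chosen earlier. *)
Lemma exists_concentrated : exists F : set (nat -> nat),
  ~ bounded_family F /\ forall g, ~ has_continuum (F `\` stem_nbhd g).
Proof.
have [[F [unbddF smallF]]|small_bdd] := pselect (exists F : set (nat -> nat),
    ~ bounded_family F /\ ~ has_continuum F).
  by exists F; split=> // g /(has_continuum_subset (@subDsetl _ _ _)).
have [W [lt [e [e_onto tri thin]]]] := exists_thin_wellorder.
have /choice[h hP] b : exists h : nat -> nat, W b ->
    forall a, W a -> ~~ lt b a -> dominated (e a) h.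
  have [Wb|nWb] := pselect (W b); last by exists (fun=> 0%N).
  have [h0 h0P] : bounded_family (e @` [set a | W a /\ lt a b]).
    apply: contrapT => unbdd; apply: small_bdd.
    eexists; split; first exact: unbdd.
    by move=> /has_continuum_image; exact: thin.
  exists (fun n => maxn (h0 n) (e b n)) => _ a Wa nba.
  have [ab|[->|ba]] := tri a b; last by rewrite ba in nba.
    have [m mP] : dominated (e a) h0 by apply: h0P; exists a.
    by exists m => n mn; rewrite leq_max mP.
  by exists 0%N => n _; rewrite leq_max leqnn orbT.
have /choice[x xP] b := exists_generic (h b) (e b).
exists (x @` W); split=> [[g gP]|g].
  have [b Wb eb] := e_onto g.
  by apply: (xP b).2; rewrite eb; apply: gP; exists b.
have [a Wa ea] := e_onto g.
have sub : (x @` W) `\` stem_nbhd g `<=` x @` [set b | W b /\ lt b a].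
  move=> _ [[b Wb <-] far]; exists b => //; split=> //.
  apply: contrapT => /negP nba; apply: far.
  have [m mP] := hP b Wb a Wa nba.
  have [n mn xn] := (xP b).1 m.
  by exists n => i ig; apply: xn; rewrite (leq_trans ig)// -ea mP.
by move=> /(has_continuum_subset sub)/has_continuum_image; exact: thin.
Qed.

(** * Cantor sets avoiding a sequence of reals *)

(** Cut [[l, l + w]] into fifths and keep the first, third and fifth. The
separating gaps have length [w / 5], so at most one of the three comes within
[w / 10] of [y]; discard one so that both others stay away, and let [b] select
between those. *)
Definition cantor_child (R : realType) (l w y : R) (b : bool) : R :=
  if y <= l + 3 / 10 * w then l + (if b then 4 / 5 else 2 / 5) * w
  else if y <= l + 7 / 10 * w then l + (if b then 4 / 5 else 0) * w
  else l + (if b then 2 / 5 else 0) * w.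

Lemma cantor_childP (R : realType) (l w y : R) : 0 < w ->
  [/\ forall b, l <= cantor_child l w y b <= l + 4 / 5 * w,
      cantor_child l w y false + w / 5 < cantor_child l w y true
    & forall b z, cantor_child l w y b <= z <= cantor_child l w y b + w / 5 ->
        w / 10 <= `|z - y|].
Proof.
move=> w0; rewrite /cantor_child.
case: (lerP y (l + 3 / 10 * w)) => y1;
  last case: (lerP y (l + 7 / 10 * w)) => y2.
all: split=> [b||b z]; try (case: b); try lra.
all: by move=> /andP[? ?]; rewrite ler_normr; apply/orP; (left; lra) || (right; lra).
Qed.

(** Nested intervals: [l b n] is the left end of the interval of length
[(c - a) / 5 ^ n] reached by the first [n] bits of [b], and the choice at
stage [n] keeps away from [y n]. *)
Lemma cantor_avoiding (R : realType) (a c : R) (y : nat -> R) : a < c ->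
  exists (L : (nat -> bool) -> R) (eps : nat -> R),
    [/\ injective L, forall b, a <= L b <= c, forall n, 0 < eps n
      & forall n b, eps n <= `|L b - y n|].
Proof.
move=> ac.
pose w n : R := (c - a) / 5 ^+ n.
have w0 n : 0 < w n by rewrite divr_gt0 ?subr_gt0// exprn_gt0.
have wS n : w n.+1 = w n / 5 by rewrite /w exprSr invfM mulrA.
pose l (b : nat -> bool) := fix l n : R :=
  if n is k.+1 then cantor_child (l k) (w k) (y k) (b k) else a.
have lS b n : l b n.+1 = cantor_child (l b n) (w n) (y n) (b n) by [].
have step b n : l b n <= l b n.+1 /\ l b n.+1 + w n.+1 <= l b n + w n.
  have [/(_ (b n))/andP[? ?] _ _] := cantor_childP (l b n) (y n) (w0 n).
  by rewrite lS wS; split=> //; have := w0 n; lra.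
have mono b n d : l b n <= l b (d + n)%N /\
    l b (d + n)%N + w (d + n)%N <= l b n + w n.
  elim: d => [//|d [IH1 IH2]]; have [S1 S2] := step b (d + n)%N.
  by split; [exact: le_trans S1|exact: le_trans IH2].
have lw b m n : l b m <= l b n + w n.
  have [mn|nm] := leqP m n.
    have [+ _] := mono b m (n - m)%N; rewrite subnK// => /le_trans; apply.
    by rewrite lerDl ltW.
  have [_] := mono b n (m - n)%N; rewrite subnK 1?ltnW//.
  by apply: le_trans; rewrite lerDl ltW.
pose L b := sup (range (l b)).
have Lbnd b n : l b n <= L b <= l b n + w n.
  apply/andP; split.
    by apply: ub_le_sup; [exists (l b n + w n) => _ [m _ <-]|exists n].
  by apply: ge_sup => [|_ [m _ <-]//]; exists (l b 0%N), 0%N.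
exists L, (fun n => w n / 10); split.
- move=> b b' Lbb'; apply: contrapT => nbb'.
  have [n bn minn] : exists2 n, b n <> b' n & forall i, (i < n)%N -> b i = b' i.
    have ex : exists n, b n != b' n.
      apply: contrapT => nex; apply: nbb'; apply/funext => n.
      by apply: contrapT => /eqP bn; apply: nex; exists n.
    exists (ex_minn ex); case: ex_minnP => m bm mmin; first exact/eqP.
    move=> i im; apply/eqP; apply: contraTT im => /mmin.
    by rewrite -leqNgt.
  have lE : l b n = l b' n.
    have: forall m, (m <= n)%N -> l b m = l b' m.
      by elim=> // m IH mn; rewrite !lS IH 1?ltnW// minn.
    exact.
  have := Lbnd b n.+1; have := Lbnd b' n.+1; rewrite !lS -lE Lbb' wS.
  have [_ sep _] := cantor_childP (l b n) (y n) (w0 n).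
  case: (b n) (b' n) bn => -[]// _ /andP[? ?] /andP[? ?]; lra.
- by move=> b; have := Lbnd b 0%N; rewrite /w expr0 divr1 addrCA subrr addr0.
- by move=> n; rewrite divr_gt0.
- move=> n b; have := Lbnd b n.+1; rewrite lS wS.
  by have [_ _ far] := cantor_childP (l b n) (y n) (w0 n) => /far.
Qed.

(** * The space *)

Section ConcentratedSpace.
Context {R : realType} {F : set (nat -> nat)}.
Local Notation X := (baire_subspace R (range stem `|` F)).

Let center (n : nat) : X :=
  exist _ (stem n) (or_introl (ex_intro2 _ _ n I erefl)).

Lemma concentrated_separable : separable X.
Proof.
exists (range center); first exact: (sub_countable (card_image_le _ _)).
move=> O [x Ox] Oopen.
have [n nO] := nbhs_agree (open_nbhs_nbhs (conj Oopen Ox)).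
have [m _ mx] := stem_cofinal (mkseq (sval x) n) 0.
exists (center m); split; last by exists m.
by apply: nO => i ilt /=; rewrite mx nth_mkseq.
Qed.

(** If [[a, c]] is in the range, preimages of the points of a Cantor set that
avoids the images of the stems lie outside a neighborhood of the stems, by
continuity at each stem. They lie therefore in [F], and there are too many. *)
Lemma concentrated_no_interval (f : X -> R) :
  (forall g, ~ has_continuum (F `\` stem_nbhd g)) ->
  continuous f -> ~ nondegenerate_interval (range f).
Proof.
move=> conc fcont [itv [a [c [fa fc ac]]]].
have [L [eps [L_inj Lac eps0 far]]] := cantor_avoiding (f \o center) ac.
have /choice[xi fxi] b : exists x, f x = L b.
  by have [x _ <-] := itv _ _ fa fc _ (Lac b); exists x.
have /choice[g gP] n : exists k, forall x : X,
    agree k (sval x) (stem n) -> `|f x - f (center n)| < eps n.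
  have [k kP] := nbhs_agree (fcont (center n) _ (nbhsx_ballx _ _ (eps0 n))).
  by exists k => x /kP; rewrite /ball/= distrC.
have off b n : ~ agree (g n) (sval (xi b)) (stem n).
  by move=> /gP; rewrite fxi ltNge far.
apply: (conc g); exists (sval \o xi) => [b b' /= xib|b].
  by apply: L_inj; rewrite -!fxi; congr f; exact: eq_sig_hprop xib.
split; last by move=> [n]; exact: off.
have [[n _ xn]|//] := svalP (xi b).
by case: (off b n) => i _; rewrite -xn.
Qed.

End ConcentratedSpace.

Theorem theorem6p1 (R : realType) (t : R) :
  exists X : metricType R,
    [/\ separable X,
        (t%:E <= packing_dim [set: X])%E
      & forall f : X -> R, continuous f -> ~ nondegenerate_interval (range f)].
Proof.
have [F [unbddF conc]] := exists_concentrated.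
exists (baire_subspace R (range stem `|` F)); split.
- exact: concentrated_separable.
- rewrite packing_dim_unbounded ?leey// => -[h hP]; apply: unbddF.
  by exists h => x Fx; apply: hP; right.
- by move=> f; exact: concentrated_no_interval.
Qed.
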